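(* Let $C$ be a curve with nodes $P_1,\dots,P_\delta$, and suppose that each node $P_i$ connects two different irreducible components of $C$. Let $\underline k=(k_1,\dots,k_\delta)$ be a $\delta$-tuple of nonnegative integers and let $S=\{i\in\{1,\dots,\delta\}: k_i\neq 0\}$. Then $$c(B_{\underline k}C)=\sum_{T\subseteq S}\Big(\prod_{i\in T}k_i\Big)\,c(N_TC).$$
   Context: A curve is a connected reduced nodal curve, projective over an algebraically closed field. The dual graph $\Gamma_C$ of a nodal curve $C$ has one vertex for each irreducible component of $C$ and one edge for each node, joining the vertices of the (possibly equal) components on which the node lies. The complexity $c(\Gamma)$ of a graph $\Gamma$ is the number of its spanning trees (parallel edges distinguished); it is $0$ if $\Gamma$ is not connected. For a nodal curve $C$, possibly disconnected, $c(C):=c(\Gamma_C)$. For a node $P$ of $C$, $N_PC$ is the (partial) normalisation of $C$ at $P$; on dual graphs, this deletes the edge corresponding to $P$. For $T\subseteq\{1,\dots,\delta\}$, $N_TC$ is the normalisation of $C$ at all the nodes $P_i$ with $i\in T$ (so $N_\emptyset C=C$); it may be disconnected. The blow up $B_PC$ of $C$ in a node $P$ is the curve obtained from $N_PC$ by attaching a $\mathbb P^1$, joining two distinct points of it to the two preimages of $P$ in $N_PC$; on dual graphs, this replaces the edge of $P$ by two edges through a new vertex. Blowing up $k$ times the node $P$ yields the curve obtained by attaching a chain of $k$ smooth rational components to the two preimages of $P$ in $N_PC$ (on dual graphs: the edge of $P$ is replaced by a path of $k+1$ edges with $k$ new intermediate vertices). $B_{\underline k}C$ denotes the curve obtained by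 performing $k_i$ blow ups on the node $P_i$ for each $i=1,\dots,\delta$ (the order is irrelevant). Empty products equal $1$. *)

(* Defs.v *)
From mathcomp Require Import all_boot all_order all_algebra.
From mathcomp Require Import boolp.
Set Implicit Arguments.
Unset Strict Implicit.
Unset Printing Implicit Defensive.
Import GRing.Theory.

(* Loops and parallel edges are allowed.  The order of the two ends of an
   edge carries no information. *)
Record multigraph := Multigraph {
  vertex : finType;
  edge : finType;
  ends : edge -> vertex * vertex }.

Section Graph.
Variable G : multigraph.

Definition adjacent (F : {set edge G}) : rel (vertex G) :=
  fun x y => [exists e in F, (ends e == (x, y)) || (ends e == (y, x))].

Definition spanning_connected (F : {set edge G}) : Prop :=
  0 < #|vertex G| /\ forall x y : vertex G, connect (adjacent F) x y.

(* A traversal of the edge [d.1], in one of its two directions. *)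
Definition dart := (edge G * bool)%type.
Definition dart_src (d : dart) := if d.2 then (ends d.1).2 else (ends d.1).1.
Definition dart_tgt (d : dart) := if d.2 then (ends d.1).1 else (ends d.1).2.

(* A loop is a cycle of length 1, two parallel edges form a cycle of
   length 2. *)
Definition graph_cycle (c : seq dart) : Prop :=
  [/\ c != [::],
      cycle (fun d d' => dart_tgt d == dart_src d') c,
      uniq [seq dart_src d | d <- c] &
      uniq [seq d.1 | d <- c]].

Definition acyclic (F : {set edge G}) : Prop :=
  forall c : seq dart, graph_cycle c -> ~ all (fun d => d.1 \in F) c.

Definition spanning_tree (F : {set edge G}) : Prop :=
  spanning_connected F /\ acyclic F.

Definition graph_complexity : nat :=
  #|[set F : {set edge G} | `[< spanning_tree F >]]|.

Definition graph_connected : Prop := spanning_connected [set: edge G].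

End Graph.

(* A smooth irreducible projective curve over K is given by its function
   field, i.e. a finitely generated extension of K of transcendence degree 1,
   and its closed points are the valuation rings of that field over K. *)

Local Open Scope ring_scope.

Record smooth_curve (K : closedFieldType) := SmoothCurve {
  funfield : fieldType;
  constant : {rmorphism K -> funfield};
  (* There is [t] transcendental over K such that [funfield] is spanned over
     K(t) by a finite family [s]; denominators are cleared in the second
     clause. *)
  funfield_tr_deg1 : exists t : funfield,
    (forall p : {poly K}, p != 0 -> (map_poly constant p).[t] != 0) /\
    (exists s : seq funfield, forall y : funfield,
       exists (q : {poly K}) (p : nat -> {poly K}), q != 0 /\
         (map_poly constant q).[t] * y =
         \sum_(i < size s) (map_poly constant (p i)).[t] * s`_i) }.

Record point (K : closedFieldType) (X : smooth_curve K) := Point {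
  regular_at : funfield X -> Prop;
  regular_constant : forall a, regular_at (constant X a);
  regularB : forall f g, regular_at f -> regular_at g -> regular_at (f - g);
  regularM : forall f g, regular_at f -> regular_at g -> regular_at (f * g);
  regular_valuation : forall f, regular_at f \/ regular_at f^-1;
  regular_proper : exists f, ~ regular_at f }.

Section ProjectiveLine.
Variable K : closedFieldType.

Notation frac p := (tofrac (p : {poly K})).

Lemma fracP (f : {fraction {poly K}}) :
  exists p q : {poly K}, q != 0 /\ f = frac p / frac q.
Proof.
elim/quotW: f => r; exists r.1, r.2; have r2 := denom_ratioP r; split => //.
have r2F : frac r.2 != 0 by rewrite tofrac_eq0.
apply: (mulIf r2F); rewrite divfK //; unlock tofrac.
rewrite -[LHS]FracField.pi_mul; apply/eqmodP => /=.
by rewrite FracField.equivfE /FracField.mulf /= !numden_Ratio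
  ?mulr1 ?mul1r ?oner_neq0 // mulrC.
Qed.

Definition line_constant : {rmorphism K -> {fraction {poly K}}} :=
  (@tofrac {poly K}) \o (@polyC K).

Lemma line_constantE (p : {poly K}) :
  (map_poly line_constant p).[frac 'X] = frac p.
Proof.
rewrite -[p in RHS]coefK poly_def rmorph_sum /=.
rewrite horner_coef size_map_poly; apply: eq_bigr => i _.
by rewrite coef_map /= -mul_polyC rmorphM rmorphXn.
Qed.

Lemma line_tr_deg1 : exists t : {fraction {poly K}},
  (forall p : {poly K}, p != 0 -> (map_poly line_constant p).[t] != 0) /\
  (exists s : seq {fraction {poly K}}, forall y : {fraction {poly K}},
     exists (q : {poly K}) (p : nat -> {poly K}), q != 0 /\
       (map_poly line_constant q).[t] * y =
       \sum_(i < size s) (map_poly line_constant (p i)).[t] * s`_i).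
Proof.
exists (frac 'X); split=> [p p0|]; first by rewrite line_constantE tofrac_eq0.
exists [:: 1] => y; have [p [q [q0 ->]]] := fracP y.
exists q, (fun=> p); split => //.
by rewrite big_ord1 /= mulr1 !line_constantE mulrCA divff ?mulr1 ?tofrac_eq0.
Qed.

Definition projective_line : smooth_curve K := SmoothCurve line_tr_deg1.

Definition regular0 (f : {fraction {poly K}}) : Prop :=
  exists p q : {poly K}, q.[0] != 0 /\ f = frac p / frac q.

Definition regular_infty (f : {fraction {poly K}}) : Prop :=
  exists p q : {poly K},
    [/\ q != 0, (size p <= size q)%N & f = frac p / frac q].

Lemma horner_neq0 (q : {poly K}) a : q.[a] != 0 -> q != 0.
Proof. by apply: contraNneq => ->; rewrite horner0. Qed.

Lemma frac_subE (p q p' q' : {poly K}) : q != 0 -> q' != 0 ->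
  frac p / frac q - frac p' / frac q' = frac (p * q' - p' * q) / frac (q * q').
Proof.
move=> q0 q'0; rewrite -mulNr addf_div ?tofrac_eq0 //.
by rewrite rmorphB !rmorphM /= mulNr.
Qed.

Lemma frac_mulE (p q p' q' : {poly K}) :
  (frac p / frac q) * (frac p' / frac q') = frac (p * p') / frac (q * q').
Proof. by rewrite mulf_div !rmorphM. Qed.

Lemma regular0_constant a : regular0 (constant projective_line a).
Proof.
exists a%:P, 1; split; first by rewrite hornerC oner_neq0.
by rewrite tofrac1 divr1.
Qed.

Lemma regular0B f g : regular0 f -> regular0 g -> regular0 (f - g).
Proof.
move=> [p [q [q0 ->]]] [p' [q' [q'0 ->]]].
exists (p * q' - p' * q), (q * q'); split; first by rewrite hornerM mulf_neq0.
by rewrite frac_subE ?(horner_neq0 q0) ?(horner_neq0 q'0).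
Qed.

Lemma regular0M f g : regular0 f -> regular0 g -> regular0 (f * g).
Proof.
move=> [p [q [q0 ->]]] [p' [q' [q'0 ->]]].
exists (p * p'), (q * q'); split; first by rewrite hornerM mulf_neq0.
by rewrite frac_mulE.
Qed.

Lemma regular0_valuation f : regular0 f \/ regular0 f^-1.
Proof.
have [p [q [q0 ->]]] := fracP f.
have [p0|p0] := eqVneq p 0.
  left; exists 0, 1; split; first by rewrite hornerC oner_neq0.
  by rewrite p0 tofrac0 !mul0r.
(* Divide [p] and [q] by the largest power of 'X dividing one of them. *)
have [m [u u0 Ep]] := multiplicity_XsubC p 0.
have [n [v v0 Eq]] := multiplicity_XsubC q 0.
move: u0 v0; rewrite p0 q0 /= => u0 v0.
rewrite subr0 in Ep Eq.
have X0 k : frac 'X^k != 0 by rewrite tofrac_eq0 monic_neq0 ?monicXn.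
have [le|/ltnW le] := leqP n m; [left|right].
  exists (u * 'X^(m - n)), v; split; first exact: v0.
  by rewrite Ep Eq -[in 'X^m](subnK le) exprD mulrA !rmorphM /=
    -mulf_div divff ?mulr1.
exists (v * 'X^(n - m)), u; split; first exact: u0.
by rewrite Ep Eq -[in 'X^n](subnK le) exprD mulrA !rmorphM /= invf_div
  -mulf_div divff ?mulr1.
Qed.

Lemma regular0_proper : exists f, ~ regular0 f.
Proof.
exists (frac 'X)^-1 => -[p [q [q0 /eqP]]].
have X0 : frac 'X != 0 by rewrite tofrac_eq0 polyX_eq0.
rewrite -[X in X == _]mul1r eqr_div ?tofrac_eq0 ?(horner_neq0 q0) ?polyX_eq0 //.
rewrite mul1r -rmorphM tofrac_eq => /eqP Eq.
by move: q0; rewrite Eq hornerM hornerX mulr0 eqxx.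
Qed.

Definition line_zero : point projective_line :=
  @Point K projective_line regular0 regular0_constant regular0B regular0M
    regular0_valuation regular0_proper.

Lemma regular_infty_constant a : regular_infty (constant projective_line a).
Proof.
exists a%:P, 1; split; first exact: oner_neq0.
  by rewrite size_poly1 size_polyC leq_b1.
by rewrite tofrac1 divr1.
Qed.

Lemma regular_inftyB f g :
  regular_infty f -> regular_infty g -> regular_infty (f - g).
Proof.
move=> [p [q [q0 le ->]]] [p' [q' [q'0 le' ->]]].
have szM (a b c d : {poly K}) : b != 0 -> d != 0 ->
    (size a <= size b)%N -> (size c <= size d)%N ->
    (size (a * c)%R <= size (b * d)%R)%N.
  move=> b0 d0 ab cd; rewrite (size_mul b0 d0).
  by apply: leq_trans (size_polyMleq _ _) _; rewrite -!subn1 leq_sub2r ?leq_add.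
exists (p * q' - p' * q), (q * q'); split; first by rewrite mulf_neq0.
  apply: leq_trans (size_polyD _ _) _; rewrite size_polyN geq_max.
  by rewrite szM //= (mulrC p') szM.
by rewrite frac_subE.
Qed.

Lemma regular_inftyM f g :
  regular_infty f -> regular_infty g -> regular_infty (f * g).
Proof.
move=> [p [q [q0 le ->]]] [p' [q' [q'0 le' ->]]].
exists (p * p'), (q * q'); split; [by rewrite mulf_neq0| |exact: frac_mulE].
rewrite (size_mul q0 q'0).
by apply: leq_trans (size_polyMleq _ _) _; rewrite -!subn1 leq_sub2r ?leq_add.
Qed.

Lemma regular_infty_valuation f : regular_infty f \/ regular_infty f^-1.
Proof.
have [p [q [q0 ->]]] := fracP f.
have [le|lt] := leqP (size p) (size q); [left|right].
  by exists p, q.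
exists q, p; split; [|exact: ltnW|by rewrite invf_div].
by rewrite -size_poly_gt0; apply: leq_ltn_trans lt.
Qed.

Lemma regular_infty_X : ~ regular_infty (frac 'X).
Proof.
move=> [p [q [q0 le /eqP]]].
rewrite -(inj_eq (mulIf (_ : frac q != 0))) ?tofrac_eq0 // divfK ?tofrac_eq0 //.
rewrite -rmorphM tofrac_eq => /eqP Ep.
by move: le; rewrite -Ep mulrC size_mulX // ltnn.
Qed.

Lemma regular_infty_proper : exists f, ~ regular_infty f.
Proof. by exists (frac 'X); exact: regular_infty_X. Qed.

Definition line_infty : point projective_line :=
  @Point K projective_line regular_infty regular_infty_constant regular_inftyB
    regular_inftyM regular_infty_valuation regular_infty_proper.

Lemma line_zero_neq_infty : line_zero <> line_infty.
Proof.
move=> E; apply: regular_infty_X.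
have : regular_at line_zero (frac 'X).
  exists 'X, 1; split; first by rewrite hornerC oner_neq0.
  by rewrite tofrac1 divr1.
by rewrite E.
Qed.

End ProjectiveLine.

Local Close Scope ring_scope.

(* A reduced nodal projective curve over K, possibly disconnected, is given by
   its normalisation and the pairs of points that are glued to its nodes:
   - [component] is the set of its irreducible components;
   - [normal v] is the normalisation of the component [v];
   - [branch P false] and [branch P true] are the two points of the
     normalisation lying over the node [P].  They may be on the same
     component; their order carries no information.
   Neither the two preimages of one node nor those of different nodes may
   coincide. *)
Record nodal_curve (K : closedFieldType) := NodalCurve {
  component : finType;
  normal : component -> smooth_curve K;
  node : finType;
  branch : node -> bool -> {v : component & point (normal v)};
  branch_inj : forall P P' b b',
    branch P b = branch P' b' -> P = P' /\ b = b' }.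

Definition dual_graph (K : closedFieldType) (C : nodal_curve K) : multigraph :=
  @Multigraph (component C) (node C)
    (fun P => (tag (branch P false), tag (branch P true))).

(* Irreducible components are connected, so that a nonempty nodal curve is
   connected if and only if any two of its components are joined by a chain of
   components in which consecutive ones meet in a node. *)
Definition curve_connected (K : closedFieldType) (C : nodal_curve K) : Prop :=
  graph_connected (dual_graph C).

Definition complexity (K : closedFieldType) (C : nodal_curve K) : nat :=
  graph_complexity (dual_graph C).

Section Operations.
Variables (K : closedFieldType) (C : nodal_curve K).

Section PartialNormalisation.
Variable T : {set node C}.

Definition pn_node : finType := {P : node C | P \notin T}.

Definition pn_branch (P : pn_node) (b : bool) := branch (val P) b.

Lemma pn_branch_inj P P' b b' :
  pn_branch P b = pn_branch P' b' -> P = P' /\ b = b'.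
Proof. by move=> /branch_inj [/val_inj ]. Qed.

Definition partial_normalisation : nodal_curve K :=
  @NodalCurve K (component C) (@normal K C) pn_node pn_branch pn_branch_inj.

End PartialNormalisation.

Section BlowUp.
Variable k : node C -> nat.

(* The projective lines over the node [P] are numbered 0, ..., k P - 1 and the
   nodes over [P] are numbered 0, ..., k P.  The node [j] joins the line
   [j - 1] (at infinity) to the line [j] (at zero), where the preimage
   [branch P false] replaces the line "-1" and the preimage [branch P true]
   replaces the line "k P".  For [k P = 0], the node [P] is unchanged. *)

Definition bu_line : finType := {P : node C & 'I_(k P)}.
Definition bu_component : finType := (component C + bu_line)%type.
Definition bu_node : finType := {P : node C & 'I_(k P).+1}.

Definition bu_normal (v : bu_component) : smooth_curve K :=
  match v with inl w => normal w | inr _ => projective_line K end.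

Definition bu_point := {v : bu_component & point (bu_normal v)}.

Definition bu_old (x : {v : component C & point (normal v)}) : bu_point :=
  existT (fun v => point (bu_normal v)) (inl (tag x)) (tagged x).

Definition bu_new (l : bu_line) (x : point (projective_line K)) : bu_point :=
  existT (fun v => point (bu_normal v)) (inr l) x.

Definition bu_branch (Q : bu_node) (b : bool) : bu_point :=
  let P := tag Q in
  let line i : bu_line := Tagged (fun P => 'I_(k P)) i in
  if b then
    (* [unlift ord_max j] is [Some j] for [j < k P], and [None] for [j = k P] *)
    match unlift ord_max (tagged Q) with
    | Some i => bu_new (line i) (line_zero K)
    | None => bu_old (branch P true)
    end
  else
    (* [unlift ord0 j] is [Some (j - 1)] for [0 < j], and [None] for [j = 0] *)
    match unlift ord0 (tagged Q) with
    | Some i => bu_new (line i) (line_infty K)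
    | None => bu_old (branch P false)
    end.

Definition bu_old_part (x : bu_point) :
    option {v : component C & point (normal v)} :=
  let: existT v y := x in
  match v return point (bu_normal v) -> option _ with
  | inl w => fun y => Some (existT (fun v => point (normal v)) w y)
  | inr _ => fun=> None
  end y.

Definition bu_new_part (x : bu_point) :
    option (bu_line * point (projective_line K)) :=
  let: existT v y := x in
  match v return point (bu_normal v) -> option (bu_line * point (projective_line K))
  with
  | inl _ => fun=> None
  | inr l => fun y => Some (l, y)
  end y.

Lemma bu_old_inj : injective bu_old.
Proof. by move=> [v x] [w y] /(congr1 bu_old_part) /= /Some_inj. Qed.

Lemma bu_new_inj l x l' x' : bu_new l x = bu_new l' x' -> l = l' /\ x = x'.
Proof. by move=> /(congr1 bu_new_part) [-> ->]. Qed.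

Lemma bu_old_neq_new x l y : bu_old x <> bu_new l y.
Proof. by move=> /(congr1 bu_new_part). Qed.

Lemma bu_branch_inj Q Q' b b' :
  bu_branch Q b = bu_branch Q' b' -> Q = Q' /\ b = b'.
Proof.
have zi := @line_zero_neq_infty K.
pose node_ord P := 'I_(k P).+1.
pose lift_line (h : forall P, 'I_(k P).+1) (l : bu_line) : bu_node :=
  Tagged node_ord (lift (h (tag l)) (tagged l)).
case: Q Q' b b' => [P j] [P' j'] [] []; rewrite /bu_branch /=.
- case: unliftP => [i|] ->; case: unliftP => [i'|] ->.
  + by move=> /bu_new_inj [/(congr1 (lift_line (fun P => @ord_max (k P)))) ].
  + by move=> /esym /bu_old_neq_new.
  + by move=> /bu_old_neq_new.
  + by move=> /bu_old_inj /branch_inj [/(congr1 (fun P => Tagged node_ord (@ord_max (k P)))) ].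
- case: unliftP => [i|] _; case: unliftP => [i'|] _.
  + by move=> /bu_new_inj [].
  + by move=> /esym /bu_old_neq_new.
  + by move=> /bu_old_neq_new.
  + by move=> /bu_old_inj /branch_inj [].
- case: unliftP => [i|] _; case: unliftP => [i'|] _.
  + by move=> /bu_new_inj [_ /esym].
  + by move=> /esym /bu_old_neq_new.
  + by move=> /bu_old_neq_new.
  + by move=> /bu_old_inj /branch_inj [].
- case: unliftP => [i|] ->; case: unliftP => [i'|] ->.
  + by move=> /bu_new_inj [/(congr1 (lift_line (fun P => @ord0 (k P)))) ].
  + by move=> /esym /bu_old_neq_new.
  + by move=> /bu_old_neq_new.
  + by move=> /bu_old_inj /branch_inj [/(congr1 (fun P => Tagged node_ord (@ord0 (k P)))) ].
Qed.

Definition blow_up : nodal_curve K :=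
  @NodalCurve K bu_component bu_normal bu_node bu_branch bu_branch_inj.

End BlowUp.
End Operations.

(* Main.v *)
Require Import Defs.
From mathcomp Require Import all_boot all_order all_algebra.
From mathcomp Require Import boolp.

(** Blowing up only subdivides the edges of the dual graph, so the formula is a
    statement about an arbitrary multigraph [G], whose edge [e] is replaced by a
    chain of [k e + 1] pieces.

    A spanning tree of the subdivision omits at most one piece of each chain:
    the vertices between two omitted pieces would be cut off.  The edges of [G]
    none of whose pieces is omitted then form a spanning tree [A] of [G], and
    conversely a spanning tree [A] is obtained from every choice of one piece to
    omit over each edge outside [A] ([spanning_tree_subdivision],
    [card_cut_at_most_once_whole]).  Hence
      c(subdivision) = sum over A of the product of (k e + 1) for e not in A.
    Expanding the product gives the sum, over the sets [T] of edges that [A]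
    avoids, of the products of [k e] for [e] in [T].  Now exchange the two sums:
    the spanning trees of [G] avoiding [T] are those of [G] with [T] deleted
    ([graph_complexity_delete]), and a set [T] containing an edge with [k e = 0]
    contributes nothing.

    To compare spanning trees without handling cycles, they are characterised
    once and for all as the connected spanning sets of edges from which no edge
    can be removed ([spanning_treeE]); it then suffices to know which sets of
    pieces are connected ([spanning_connected_subdivision]). *)

Set Implicit Arguments.
Unset Strict Implicit.
Unset Printing Implicit Defensive.

(** * Spanning trees as minimal connected sets of edges *)

Lemma notin_setD1 (T : finType) (A : {set T}) a x :
  (x \notin A :\ a) = (x == a) || (x \notin A).
Proof. by rewrite in_setD1 negb_and negbK. Qed.

Section SpanningTrees.
Variable G : multigraph.
Implicit Types (F : {set edge G}) (x y : vertex G) (d : dart G).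

Lemma adjacentP F x y :
  reflect (exists2 d : dart G, d.1 \in F & dart_src d = x /\ dart_tgt d = y)
          (adjacent F x y).
Proof.
apply: (iffP existsP) => [[e /andP[eF /orP[]/eqP E]]|[[e []] /= eF [<- <-]]].
- by exists (e, false); rewrite //= /dart_src /dart_tgt /= E.
- by exists (e, true); rewrite //= /dart_src /dart_tgt /= E.
- by exists e; rewrite eF /dart_src /dart_tgt /= -surjective_pairing eqxx orbT.
- by exists e; rewrite eF /dart_src /dart_tgt /= -surjective_pairing eqxx.
Qed.

Lemma adjacent_dart F d : d.1 \in F -> adjacent F (dart_src d) (dart_tgt d).
Proof. by move=> dF; apply/adjacentP; exists d. Qed.

Lemma adjacent_sym F : symmetric (adjacent F).
Proof. by move=> x y; apply: eq_existsb => e; rewrite orbC. Qed.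

Lemma connect_adjacentC F : connect_sym (adjacent F).
Proof. exact/sym_connect_sym/adjacent_sym. Qed.

Lemma connect_edge F e :
  e \in F -> connect (adjacent F) (ends e).1 (ends e).2.
Proof. by move=> eF; apply/connect1/(@adjacent_dart F (e, false)). Qed.

Definition trail : rel (dart G) := fun d d' => dart_tgt d == dart_src d'.

Lemma connect_trail F d c d' :
  path trail d (rcons c d') -> {in c, forall d0, d0.1 \in F} ->
  connect (adjacent F) (dart_tgt d) (dart_src d').
Proof.
elim: c d => [|d1 c IH] d /=; first by rewrite andbT => /eqP->.
move=> /andP[/eqP-> /IH{}IH] cF; apply: connect_trans (IH _).
  by apply/connect1/adjacent_dart/cF; rewrite mem_head.
by move=> d0 d0c; apply: cF; rewrite inE d0c orbT.
Qed.

(** The edges are distinct because the source of each dart is not met again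
    further along the path. *)
Lemma simple_trail F x p :
    path (adjacent F) x p -> uniq (x :: p) ->
  exists c : seq (dart G),
    [/\ {in c, forall d, d.1 \in F}, uniq [seq d.1 | d <- c],
        [seq dart_src d | d <- c] = belast x p,
        [seq dart_tgt d | d <- c] = p &
        forall d, dart_tgt d = x ->
          path trail d c /\ dart_tgt (last d c) = last x p].
Proof.
elim: p x => [|y p IH] x /=; first by exists [::].
case/andP=> /adjacentP[d dF [dx dy]] pP /andP[xp yp].
have [c [cF cU cS cT cP]] := IH y pP yp.
exists (d :: c); split=> /=.
- by move=> d1; rewrite inE => /predU1P[->|/cF].
- rewrite cU andbT; apply: contra xp => /mapP[d' d'c dd'].
  have yE : x = dart_src d' \/ x = dart_tgt d'.
    by rewrite -dx /dart_src /dart_tgt dd'; case: d.2 d'.2 => [] []; auto.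
  case: yE => ->.
    by apply: mem_belast; rewrite -cS map_f.
  by rewrite inE -cT map_f ?orbT.
- by rewrite dx cS.
- by rewrite dy cT.
- by move=> d0 d0x; rewrite /trail d0x dx eqxx; exact: cP.
Qed.

Lemma spanning_connected_sub F F' :
    subrel (adjacent F) (connect (adjacent F')) ->
  spanning_connected F -> spanning_connected F'.
Proof. by move=> sFF' [V0 FC]; split=> // x y; apply: connect_sub (FC x y). Qed.

(** The edge [e] lies on a cycle of [F] exactly when its ends remain joined
    once [e] is removed. *)
Lemma spanning_treeE F :
  spanning_tree F <->
  spanning_connected F /\ forall e, e \in F -> ~ spanning_connected (F :\ e).
Proof.
split=> -[FC Fmin]; split=> //.
  move=> e eF [_ /(_ (ends e).2 (ends e).1)/connectP[p pP pE]].
  case/shortenP: pP pE => {}p pP pU _ pE.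
  have [c [cF cU cS cT cP]] := simple_trail pP pU.
  apply: (Fmin ((e, false) :: c)); last first.
    by rewrite /= eF /=; apply/allP => d /cF; rewrite !inE => /andP[].
  split=> //=.
  - have [] := cP (e, false) erefl; rewrite -pE => c1 c2.
    by rewrite rcons_path c1 /= c2 eqxx.
  - rewrite cS -rcons_uniq; move: pU; rewrite lastI -pE.
    by rewrite !rcons_uniq.
  - rewrite cU andbT; apply/mapP => -[d /cF dF /= ed].
    by rewrite -ed !inE eqxx in dF.
case=> [|d c] [] // _ cP _ /=; case/andP=> dNc _ /andP[dF /allP cF].
apply: (Fmin _ dF); apply: spanning_connected_sub FC => x y.
have tgt_src : connect (adjacent (F :\ d.1)) (dart_tgt d) (dart_src d).
  apply: connect_trail cP _ => d' d'c; rewrite !inE cF // andbT.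
  by apply: contraNneq dNc => <-; rewrite map_f.
case/adjacentP=> d' d'F [<- <-].
have [dd'|dd'] := eqVneq d'.1 d.1; last first.
  by apply/connect1/adjacent_dart; rewrite !inE dd'.
move: tgt_src; rewrite /dart_src /dart_tgt dd'.
by case: d.2 d'.2 => [] [] //; rewrite connect_adjacentC.
Qed.

End SpanningTrees.

(** * Deleting edges *)

Section Deletion.
Variables (G : multigraph) (T : {set edge G}).

Definition delete_edges : multigraph :=
  @Multigraph (vertex G) {e : edge G | e \notin T} (fun e => ends (val e)).

Implicit Type F : {set edge delete_edges}.

Lemma adjacent_delete F :
  adjacent F =2 adjacent (G := G) [set val e | e in F].
Proof.
move=> x y; apply/adjacentP/adjacentP
  => [[[e b] eF exy]|[[e b] /= /imsetP[e' e'F ->] exy]].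
  by exists (val e, b); first exact: imset_f.
by exists (e', b).
Qed.

Lemma spanning_connected_delete F :
  spanning_connected F <-> spanning_connected (G := G) [set val e | e in F].
Proof.
split=> -[V0 FC]; split=> // x y; have := FC x y;
  by rewrite (eq_connect (adjacent_delete F)).
Qed.

Lemma spanning_tree_delete F :
  spanning_tree F <-> spanning_tree (G := G) [set val e | e in F].
Proof.
rewrite !spanning_treeE -spanning_connected_delete.
have D1 e : [set val e' | e' in F :\ e] = [set val e' | e' in F] :\ val e.
  apply/setP => e'; rewrite in_setD1; apply/imsetP/andP.
    case=> e0; rewrite in_setD1 => /andP[e0e e0F] ->.
    by rewrite (inj_eq val_inj) imset_f.
  case=> ne /imsetP[e0 e0F ee0]; exists e0 => //.
  by rewrite in_setD1 e0F andbT -(inj_eq val_inj) -ee0.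
split=> -[FC Fmin]; split=> // e.
  case/imsetP=> e' e'F ->; rewrite -D1 -spanning_connected_delete; exact: Fmin.
by move=> eF; rewrite spanning_connected_delete D1; apply: Fmin; apply: imset_f.
Qed.

Lemma graph_complexity_delete :
  graph_complexity delete_edges =
  #|[set F : {set edge G} | `[< spanning_tree F >] & T \subset ~: F]|.
Proof.
have vinj :
    injective (fun F : {set edge delete_edges} => [set val e | e in F]).
  exact/imset_inj/val_inj.
rewrite /graph_complexity -(card_imset _ vinj).
congr #|pred_of_set _|; apply/setP => F; apply/imsetP/idP => [[F0]|].
  rewrite !inE => /asboolP F0t ->; apply/andP; split.
    exact/asboolP/spanning_tree_delete.
  apply/subsetP => e eT; rewrite inE; apply/imsetP => -[e' _ ee'].
  by have := valP e'; rewrite -ee' eT.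
rewrite inE => /andP[/asboolP Ft TF].
have FE :
    F = [set val e | e in [set e : edge delete_edges | val e \in F]].
  apply/setP => e; apply/idP/imsetP => [eF|[e' + ->]]; last by rewrite inE.
  have eT : e \notin T by apply: contraL eF => /(subsetP TF); rewrite inE.
  by exists (Sub e eT : edge delete_edges); rewrite ?inE SubK.
exists [set e : edge delete_edges | val e \in F] => //.
by rewrite inE; apply/asboolP/spanning_tree_delete; rewrite -FE.
Qed.

End Deletion.

(** * Subdividing edges *)

Section Subdivision.
Variables (G : multigraph) (k : edge G -> nat).

Definition new_vertex : finType := {e : edge G & 'I_(k e)}.
Definition piece : finType := {e : edge G & 'I_(k e).+1}.

(** Numbering the vertices over [e] from 0 to [k e + 1], the ends of [e]
    included, lets the piece [i] join the vertices [i] and [i + 1] without case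
    distinction. *)
Definition chain (e : edge G) (i : nat) : vertex G + new_vertex :=
  if i is i'.+1 then
    if insub i' is Some l then inr (Tagged (fun e => 'I_(k e)) (l : 'I_(k e)))
    else inl (ends e).2
  else inl (ends e).1.

Definition subdivision : multigraph :=
  @Multigraph (vertex G + new_vertex)%type piece
    (fun Q => (chain (tag Q) (tagged Q), chain (tag Q) (tagged Q).+1)).

Implicit Type F : {set piece}.

Definition mkpiece (e : edge G) (i : 'I_(k e).+1) : piece :=
  Tagged (fun e => 'I_(k e).+1) i.

Local Notation joined F := (connect (adjacent (G := subdivision) F)).

Definition whole F : {set edge G} :=
  [set e | [forall j : 'I_(k e).+1, mkpiece j \in F]].

Definition cut_at_most_once F :=
  [forall e, forall i : 'I_(k e).+1, forall j : 'I_(k e).+1,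
    (mkpiece i \notin F) ==> (mkpiece j \notin F) ==> (i == j)].

Lemma cut_at_most_onceP F :
  reflect (forall e (i j : 'I_(k e).+1),
             mkpiece i \notin F -> mkpiece j \notin F -> i = j)
          (cut_at_most_once F).
Proof.
apply: (iffP 'forall_'forall_'forall_implyP) => H e i j.
  by move=> iF jF; apply/eqP; move/implyP: (H e i j iF); apply.
by move=> iF; apply/implyP => /(H _ _ _ iF)/eqP.
Qed.

Lemma wholeP F e :
  reflect (forall j : 'I_(k e).+1, mkpiece j \in F) (e \in whole F).
Proof. by rewrite inE; apply: forallP. Qed.

Lemma chain_last e : chain e (k e).+1 = inl (ends e).2.
Proof. by rewrite /chain insubF ?ltnn. Qed.

Lemma chain_new e (l : 'I_(k e)) :
  chain e l.+1 = inr (Tagged (fun e => 'I_(k e)) l).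
Proof. by rewrite /chain valK. Qed.

Lemma connect_chain F e i j :
    i <= j <= (k e).+1 ->
    (forall l : 'I_(k e).+1, i <= l < j -> mkpiece l \in F) ->
  joined F (chain e i) (chain e j).
Proof.
case/andP; elim: j => [|j IH]; first by rewrite leqn0 => /eqP->.
rewrite leq_eqVlt => /predU1P[-> //|ij jk pF].
apply: connect_trans (IH _ (ltnW jk) _) _ => //.
  by move=> l /andP[il lj]; apply: pF; rewrite il ltnW.
apply: (@connect_edge subdivision F (mkpiece (Ordinal jk : 'I_(k e).+1))).
by apply: pF; rewrite /= ltnSn andbT.
Qed.

(** A new vertex is sent to the end of its edge that it can reach inside [F],
    with the first end preferred; when it reaches neither, all that matters is
    that the vertices joined to it by a piece in [F] are sent to the same
    end. *)
Definition retract F (v : vertex subdivision) : vertex G :=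
  match v with
  | inl x => x
  | inr l =>
      if [forall i : 'I_(k (tag l)).+1, (i <= tagged l) ==> (mkpiece i \in F)]
      then (ends (tag l)).1 else (ends (tag l)).2
  end.

(** The right-hand side, unlike [retract], treats all the vertices of a chain
    alike.  The two differ only at the far end of an edge with all its pieces
    in [F], and that edge joins the two values. *)
Lemma retract_chain F e i : i <= (k e).+1 ->
  connect (adjacent (whole F)) (retract F (chain e i))
    (if [forall j : 'I_(k e).+1, (j < i) ==> (mkpiece j \in F)]
     then (ends e).1 else (ends e).2).
Proof.
case: i => [|i] ik; first by rewrite /=; case: ifP => // /negP[]; apply/forallP.
move: ik; rewrite ltnS leq_eqVlt => /predU1P[->|ik].
  rewrite chain_last /=; case: ifP => // /forallP eF.
  rewrite connect_adjacentC connect_edge //.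
  by apply/wholeP => j; have := eF j; rewrite ltn_ord.
by rewrite -[i]/(val (Ordinal ik)) chain_new.
Qed.

Lemma adjacent_retract F u v : adjacent (G := subdivision) F u v ->
  connect (adjacent (whole F)) (retract F u) (retract F v).
Proof.
suff H e (i : 'I_(k e).+1) : mkpiece i \in F ->
    connect (adjacent (whole F)) (retract F (chain e i))
      (retract F (chain e i.+1)).
  case/adjacentP=> -[[e i] []] /= /H {}H [<- <-] //.
  by rewrite connect_adjacentC.
move=> iF.
apply: connect_trans (retract_chain F _) _; first exact: ltnW (ltn_ord i).
rewrite connect_adjacentC; have := @retract_chain F e i.+1 (ltn_ord i).
congr (connect _ _ _); congr (if _ then _ else _).
apply: eq_forallb => j; rewrite ltnS leq_eqVlt.
by case: eqP => [/val_inj->|//]; rewrite [_ \in F]iF !implybT.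
Qed.

Lemma connect_retract F u v : joined F u v ->
  connect (adjacent (whole F)) (retract F u) (retract F v).
Proof.
case/connectP=> p pP ->{v}; elim: p u pP => [|v p IH] u //= /andP[uv /IH].
exact/connect_trans/adjacent_retract.
Qed.

(** Two omitted pieces of one chain would separate the vertices between them
    from the rest of the subdivision. *)
Lemma connected_cut_at_most_once F :
  spanning_connected (G := subdivision) F -> cut_at_most_once F.
Proof.
move=> [_ FC]; apply/cut_at_most_onceP => e.
suff H (i j : 'I_(k e).+1) :
    i < j -> mkpiece i \notin F -> mkpiece j \notin F -> False.
  move=> i j iF jF; apply/val_inj; case: (ltngtP i j) => // ij.
    by case: (H i j).
  by case: (H j i).
move=> ij iF jF.
(* [X] is the part of the chain strictly between the two missing pieces. *)
pose X := [pred v : vertex subdivision | if v is inr l then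
  (tag l == e) && (i <= tagged l < j) else false].
have Xchain e' n : (chain e' n \in X) = (e' == e) && (i < n <= j).
  case: n => [|n]; first by rewrite andbF.
  rewrite inE /=; case: insubP => [l _ /= ->//|nk] /=.
  apply/esym/negP => /andP[/eqP ee' /andP[_ nj]].
  by rewrite ee' (leq_trans nj) // -ltnS in nk.
have Xclosed : closed (adjacent (G := subdivision) F) X.
  apply: intro_closed (@connect_adjacentC subdivision F) _ _ => u v.
  case/adjacentP=> -[[e' l] b] /= lF [<- <-].
  have: (chain e' l \in X) = (chain e' l.+1 \in X).
    rewrite !Xchain; case: eqP => //= ee'; subst e'.
    have li : l != i by apply: contraNneq iF => <-.
    have lj : l != j by apply: contraNneq jF => <-.
    rewrite ltnS; rewrite -!(inj_eq val_inj) /= in li lj.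
    by rewrite [i <= l]leq_eqVlt eq_sym (negPf li) [l <= j]leq_eqVlt (negPf lj).
  by rewrite /dart_src /dart_tgt; case: b => /= ->.
have := closed_connect Xclosed (FC (chain e 0) (chain e i.+1)).
by rewrite !Xchain eqxx ltnSn ij.
Qed.

(** Pushing connectedness down to [G] uses the retraction; in the other
    direction, each new vertex reaches one of the ends of its edge because the
    chain is cut at most once. *)
Lemma spanning_connected_subdivision F :
  spanning_connected (G := subdivision) F <->
  spanning_connected (whole F) /\ cut_at_most_once F.
Proof.
split=> [FC|[[V0 FC] /cut_at_most_onceP Fcut]].
  split; last exact: connected_cut_at_most_once.
  case: FC => /card_gt0P[v _] FC; split=> [|x y].
    by apply/card_gt0P; exists (retract F v).
  exact: connect_retract (FC (inl x) (inl y)).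
have oldC x y : joined F (inl x) (inl y).
  have /connectP[p pP ->] := FC x y.
  elim: p x pP => //= z p IH x /andP[xz /IH]; apply: connect_trans.
  suff H e : e \in whole F ->
      joined F (inl (ends e).1) (inl (ends e).2).
    case/adjacentP: xz => -[e []] /= /H{}H [<- <-] //.
    exact: etrans (@connect_adjacentC subdivision F _ _) H.
  move/wholeP=> eF; rewrite -chain_last.
  by apply: (@connect_chain F e 0 (k e).+1); rewrite ?leqnn // => l _.
have toold (u : vertex subdivision) :
    exists x : vertex G, joined F u (inl x).
  case: u => [x|[e l]]; first by exists x.
  rewrite -[inr _](chain_new l).
  (* At most one piece is missing: go backwards along the chain if it is not
     on that side, and forwards otherwise. *)
  have [/forallP eF|/forallPn[i]] :=
    boolP [forall i : 'I_(k e).+1, (i <= l) ==> (mkpiece i \in F)].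
    exists (ends e).1; rewrite (@connect_adjacentC subdivision).
    apply: (@connect_chain F e 0 l.+1); first exact: ltnW (ltn_ord l).
    by move=> i; rewrite ltnS; apply/implyP/eF.
  rewrite negb_imply => /andP[il iF]; exists (ends e).2; rewrite -chain_last.
  apply: connect_chain; first by rewrite leqnn andbT ltnW // ltnS.
  move=> j /andP[lj _]; apply: contraTT lj => /(Fcut _ _ _ iF) <-.
  by rewrite -leqNgt.
split.
  by have /card_gt0P[x _] := V0; apply/card_gt0P; exists (inl x).
move=> u v; have [x ux] := toold u; have [y vy] := toold v.
apply: connect_trans ux (connect_trans (oldC x y) _).
by rewrite connect_adjacentC.
Qed.

(** Removing a piece over an edge [e] of [whole F] removes [e] from [whole F]
    and cuts its chain for the first time; over any other edge it cuts the
    chain a second time and disconnects.  So both minimality conditions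
    agree. *)
Lemma spanning_tree_subdivision F :
  spanning_tree (G := subdivision) F <-> spanning_tree (whole F) /\ cut_at_most_once F.
Proof.
have wholeD1 e (i : 'I_(k e).+1) : whole (F :\ mkpiece i) = whole F :\ e.
  apply/setP => e'; rewrite in_setD1; apply/wholeP/andP.
    move=> H; split; last first.
      by apply/wholeP => j; have := H j; rewrite !inE => /andP[].
    by apply/eqP => ee'; subst e'; have := H i; rewrite !inE eqxx.
  case=> ee' /wholeP H j; rewrite in_setD1 H andbT.
  by apply: contra ee' => /eqP/(congr1 tag)/= ->.
rewrite !spanning_treeE spanning_connected_subdivision.
split=> [[[wC Fcut] Fmin]|[[wC wmin] Fcut]].
  split=> //; split=> // e /wholeP eF weC.
  apply: (Fmin (mkpiece ord0 : edge subdivision)); first exact: eF.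
  apply/spanning_connected_subdivision; rewrite (wholeD1 e ord0); split=> //.
  apply/cut_at_most_onceP => e' i j; rewrite !notin_setD1.
  have [ee'|ee'] := eqVneq e' e.
    subst e'; rewrite !eF !orbF => /eqP Ei /eqP Ej.
    exact: eq_from_Tagged (etrans Ei (esym Ej)).
  have ne (l : 'I_(k e').+1) :
      (mkpiece l == mkpiece (ord0 : 'I_(k e).+1)) = false.
    by apply: contraNF ee' => /eqP/(congr1 tag)/= ->.
  by rewrite !ne /=; apply/cut_at_most_onceP.
split=> // -[e i] iF /spanning_connected_subdivision[].
rewrite (wholeD1 e i) => weC /cut_at_most_onceP eCut.
have [ew|/wholeP ew] := boolP (e \in whole F); first exact: wmin weC.
apply: ew => j; apply: contraT => jF.
have /eqP ij : i == j.
  by apply/eqP/eCut; rewrite notin_setD1 ?eqxx // jF orbT.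
by rewrite -ij [_ \in F]iF in jF.
Qed.

End Subdivision.

(** * Counting the spanning trees of a subdivision *)

Section Counting.
Variables (G : multigraph) (k : edge G -> nat).

Lemma card_pieces e : #|[pred Q : piece k | tag Q == e]| = (k e).+1.
Proof.
have mkinj : injective (@mkpiece G k e) by move=> i j; exact: eq_from_Tagged.
rewrite -[RHS](card_ord (k e).+1) -(card_image mkinj).
apply: eq_card => -[e' i]; rewrite inE /=.
apply/eqP/imageP => [ee'|[j _ []] //].
by subst e'; exists i.
Qed.

Lemma card_cut_at_most_once_whole (A : {set edge G}) :
  #|[set F : {set piece k} | cut_at_most_once F & whole F == A]| =
  \prod_(e in ~: A) (k e).+1.
Proof.
(* [F] amounts to the choice of its missing piece over each edge outside [A];
   the value [None] is taken on [A]. *)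
pose omits e := [pred o : option (piece k) |
  if o is Some Q then tag Q == e else false].
pose choices := pfamily None (mem (~: A)) omits.
pose others (f : {ffun edge G -> option (piece k)}) :=
  [set Q | f (tag Q) != Some Q].
have choiceP f : f \in choices -> forall e,
    if f e is Some Q then e \notin A /\ tag Q = e else e \in A.
  move/pfamilyP=> [/supportP f0 fA] e.
  have [eA|eA] := boolP (e \in A); first by rewrite f0 // inE eA.
  have := fA e; rewrite !inE eA => /(_ isT).
  by case: (f e) => // Q /eqP.
have mem_others f e (i : 'I_(k e).+1) :
    (mkpiece i \notin others f) = (f e == Some (mkpiece i)).
  by rewrite inE negbK.
have -> : [set F : {set piece k} | cut_at_most_once F & whole F == A] =
    [set others f | f in choices].
  apply/setP => F; rewrite inE; apply/andP/imsetP.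
    case=> /cut_at_most_onceP Fcut /eqP FA.
    exists [ffun e => [pick Q : piece k | (tag Q == e) && (Q \notin F)]].
      apply/pfamilyP; split.
        apply/supportP => e; rewrite inE negbK -FA => /wholeP eF; rewrite ffunE.
        case: pickP => // -[e' i] /= /andP[/eqP ee' /negP[]].
        by subst e'; apply: eF.
      move=> e; rewrite inE -FA => /wholeP eF; rewrite ffunE inE.
      case: pickP => [Q /andP[] //|noQ]; case: eF => i.
      by have := noQ (mkpiece i); rewrite /= eqxx /= => /negbFE.
    apply/setP => -[e i]; rewrite inE ffunE /=; apply/idP/negP => [iF /eqP|].
      by case: pickP => // Q /andP[_ QF] [QE]; rewrite QE iF in QF.
    apply: contra_notT => iF.
    case: pickP => [[e' j] /= /andP[/eqP ee' jF]|/(_ (mkpiece i))].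
      by subst e'; rewrite (Fcut _ _ _ iF jF).
    by rewrite /= eqxx iF.
  case=> f fC ->; split.
    apply/cut_at_most_onceP => e i j; rewrite !mem_others => /eqP -> /eqP/Some_inj.
    exact: eq_from_Tagged.
  apply/eqP/setP => e; apply/wholeP/idP => [eF|eA j].
    have := choiceP f fC e; case fe: (f e) => [[e' i]|] // [_ /= ee'].
    by subst e'; have := eF i; rewrite -[_ \in _]negbK mem_others fe eqxx.
  rewrite -[_ \in _]negbK mem_others.
  by have := choiceP f fC e; case: (f e) => // Q []; rewrite eA.
rewrite card_in_imset => [|f f' fC f'C ff'].
  rewrite card_pfamily foldrE big_image; apply: eq_bigr => e _.
  have Sinj : injective (@Some (piece k)) by move=> Q Q' [].
  rewrite -card_pieces -(card_image Sinj).
  apply: eq_card => -[Q|]; first by rewrite (mem_image Sinj).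
  by apply/esym/imageP => -[].
apply/ffunP => e.
have fe := choiceP f fC e; have f'e := choiceP f' f'C e.
case Ef: (f e) fe => [Q|].
  case=> _ Qe; apply/esym/eqP.
  have : Q \notin others f by rewrite inE negbK Qe Ef.
  by rewrite ff' inE negbK Qe.
by move=> eA; case: (f' e) f'e => // Q []; rewrite eA.
Qed.

Lemma prod_succ_setC (A : {set edge G}) :
  \prod_(e in ~: A) (k e).+1 =
  \sum_(T : {set edge G} | T \subset ~: A) \prod_(e in T) k e.
Proof.
have -> : \prod_(e in ~: A) (k e).+1 =
    \prod_e ((if e \in ~: A then k e else 0) + 1).
  by rewrite big_mkcond; apply: eq_bigr => e _; case: ifP; rewrite ?addn1.
rewrite bigA_distr [RHS]big_mkcond; apply: eq_bigr => T _.
rewrite -big_mkcond /=; case: ifPn => [TA|/subsetPn[e eT eA]].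
  by apply: eq_bigr => e /(subsetP TA) ->.
by rewrite (bigD1 e) //= (negPf eA).
Qed.

Lemma graph_complexity_subdivision :
  graph_complexity (subdivision k) =
  \sum_(A : {set edge G} | `[< spanning_tree A >]) \prod_(e in ~: A) (k e).+1.
Proof.
rewrite /graph_complexity -sum1_card.
rewrite (partition_big (@whole G k) (fun A => `[< spanning_tree A >])) /=;
  last first.
  by move=> F; rewrite inE => /asboolP/spanning_tree_subdivision[/asboolP].
apply: eq_bigr => A /asboolP At; rewrite -card_cut_at_most_once_whole -sum1_card.
apply: eq_bigl => F; rewrite !inE; case: eqP => [FA|]; rewrite ?andbF ?andbT //.
apply/asboolP/idP => [/spanning_tree_subdivision[] //|Fcut].
by apply/spanning_tree_subdivision; rewrite FA.
Qed.

Theorem graph_complexity_subdivision_delete :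
  graph_complexity (subdivision k) =
  \sum_(T : {set edge G} | T \subset [set e | k e != 0])
     (\prod_(e in T) k e) * graph_complexity (delete_edges T).
Proof.
rewrite graph_complexity_subdivision.
under eq_bigr do rewrite prod_succ_setC.
rewrite (exchange_big_dep xpredT) //= [RHS]big_mkcond; apply: eq_bigr => T _.
rewrite sum_nat_const graph_complexity_delete mulnC cardsE.
case: ifPn => // /subsetPn[e eT]; rewrite inE negbK => /eqP ke0.
by rewrite (bigD1 e) //= ke0 !mul0n.
Qed.

End Counting.

(** * Blow-ups of nodal curves *)

Lemma dual_graph_blow_up (K : closedFieldType) (C : nodal_curve K)
    (k : node C -> nat) :
  dual_graph (blow_up k) = @subdivision (dual_graph C) k.
Proof.
rewrite /dual_graph /subdivision; congr (@Multigraph _ _ _).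
apply/funext => -[P j]; rewrite /= /bu_branch /=; congr pair.
  case: unliftP => [i ->|-> //]; rewrite lift0.
  by rewrite (@chain_new (dual_graph C) k P i).
case: unliftP => [i ->|->]; last first.
  exact: esym (@chain_last (dual_graph C) k P).
by rewrite lift_max; exact: esym (@chain_new (dual_graph C) k P i).
Qed.

Theorem theorem3p4 (K : closedFieldType) (C : nodal_curve K)
    (C_connected : curve_connected C)
    (no_self_node : forall P : node C,
       tag (branch P false) <> tag (branch P true))
    (k : node C -> nat) :
  complexity (blow_up k) =
  \sum_(T : {set node C} | T \subset [set P | k P != 0])
     (\prod_(P in T) k P) * complexity (partial_normalisation T).
Proof.
rewrite /complexity dual_graph_blow_up.
exact: (@graph_complexity_subdivision_delete (dual_graph C) k).
Qed.
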